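(* Assume the Continuum Hypothesis. Then the set of nowhere feebly continuous functions from $\mathbb{R}^2$ to $\mathbb{R}$ is strongly $\mathfrak{c}$-algebrable (as a subset of the commutative algebra $\mathbb{R}^{\mathbb{R}^2}$ of all functions from $\mathbb{R}^2$ to $\mathbb{R}$ with pointwise operations).
   Context: Notation: $x_n\searrow x$ means that $(x_n)$ is a strictly decreasing sequence of reals converging to $x$; $\mathfrak{c}$ is the cardinality of the continuum. A function $f\colon\mathbb{R}^2\to\mathbb{R}$ is feebly continuous at $\langle x,y\rangle$ if there exist sequences $x_n\searrow x$ and $y_m\searrow y$ such that $\lim_{n\to\infty}\lim_{m\to\infty}f(x_n,y_m)=f(x,y)$ (the inner limit exists in $\mathbb{R}$ for each $n$, and the outer limit exists). $f$ is nowhere feebly continuous if it is feebly continuous at no point of $\mathbb{R}^2$. Let $L$ be a commutative linear algebra and $\kappa$ a cardinal. A set $A\subset L$ is strongly $\kappa$-algebrable if $A\cup\{0\}$ contains a $\kappa$-generated algebra that is isomorphic to a free algebra. Equivalently, there is a set $X\subset L$ of cardinality $\kappa$ (a set of free generators) such that for any $k\in\mathbb{N}$, any nonzero real polynomial $P$ in $k$ variables without constant term, and any distinct $y_1,\dots,y_k\in X$, we have $P(y_1,\dots,y_k)\neq 0$ and $P(y_1,\dots,y_k)\in A$. *)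

(* Defs.v *)
From HB Require Import structures.
From mathcomp Require Import all_boot all_order all_algebra.
From mathcomp Require Import all_classical all_reals all_analysis.
(* The notations of mpoly clash with those of mathcomp-analysis. *)
From mathcomp Require Import -(notations) mpoly.

Set Implicit Arguments.
Unset Strict Implicit.
Unset Printing Implicit Defensive.

Import Order.TTheory GRing.Theory Num.Theory.
Import numFieldNormedType.Exports.

Local Open Scope classical_set_scope.
Local Open Scope ring_scope.

(* The library provides the pointwise ring and module structures on T -> R,
   but not the algebra structure that joins them. *)
Section fct_comAlgType.
Variables (T : pointedType) (R : realType).

Let fct_scalerAl (k : R) (f g : T -> R) : k *: (f * g) = (k *: f) * g.
Proof. by apply/funext => x; exact: mulrA. Qed.

HB.instance Definition _ :=
  GRing.Lmodule_isLalgebra.Build R (T -> R) fct_scalerAl.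
HB.instance Definition _ := GRing.Lalgebra_isComAlgebra.Build R (T -> R).

End fct_comAlgType.

Definition continuum_hypothesis (R : realType) : Prop :=
  forall A : set R, countable A \/ (A #= [set: R])%card.

Definition strictly_decreases_to (R : realType) (u : R^nat) (x : R) : Prop :=
  decreasing_seq u /\ u @ \oo --> x.

Definition feebly_continuous_at (R : realType) (f : R * R -> R) (z : R * R) :
    Prop :=
  exists u v l : R^nat,
    [/\ strictly_decreases_to u z.1,
        strictly_decreases_to v z.2,
        forall n, f (u n, v m) @[m --> \oo] --> l n &
        l @ \oo --> f z].

Definition nowhere_feebly_continuous (R : realType) (f : R * R -> R) : Prop :=
  forall z, ~ feebly_continuous_at f z.

Definition poly_in (R : comNzRingType) (L : comAlgType R) (k : nat)
    (P : mpoly k R) (y : 'I_k -> L) : L :=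
  mmap (in_alg L) y P.

(* The cardinal kappa is that of the set K; X is a set of free generators. The
   free algebra is not unital, hence the condition on the constant term of P. *)
Definition strongly_algebrable (R : comNzRingType) (L : comAlgType R)
    (T : Type) (K : set T) (A : set L) : Prop :=
  exists X : set L, (X #= K)%card /\
    forall (k : nat) (P : mpoly k R) (y : 'I_k -> L),
      P != 0 -> mcoeff (@mnm0 k) P = 0 ->
      injective y -> (forall i, X (y i)) ->
      poly_in P y != 0 /\ A (poly_in P y).

(* Main.v *)
Require Import Defs.
From mathcomp Require Import all_boot all_order all_algebra.
From mathcomp Require Import all_classical all_reals all_analysis.
Import numFieldNormedType.Exports.
From mathcomp Require Import wochoice.
From mathcomp Require Import -(notations) mpoly.

Local Open Scope classical_set_scope.

Import Order.TTheory GRing.Theory Num.Theory.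
Local Open Scope ring_scope.

(** Under CH, Sierpinski splits the plane into a set A with countable horizontal
    sections and a complement with countable vertical sections. Numbering each
    of these sections injectively gives a code e(x, y) in nat that is injective
    in x along the points of A on a horizontal line, and injective in y along
    the other points of a vertical line ([sierpinski_coding]).

    Let h : nat -> R tend to +oo or to -oo. Then h(e(x, y)) has no iterated
    limit along any two injective sequences u and v ([no_iterated_limit]).
    Indeed, if h(e(u_n, v_m)) tends to l_n as m grows and (l_n) is bounded, then
    for some K and every N there is an N x N grid of points (u_n, v_m) whose
    codes are all below K: the first N rows are controlled once m is large. But
    each column of the grid has at most K points in A and each row at most K
    points outside A, so N^2 <= 2NK, which fails for N = 2K + 1. A strictly
    decreasing sequence is injective, so h(e(x, y)) is nowhere feebly
    continuous; it is not the zero function either, because zero does have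
    iterated limits.

    It remains to find continuum many sequences g_t such that every nonzero
    polynomial in them without constant term diverges to an infinity. The
    choice g_t(n) = exp(exp(e^t (n + 1))) works. A monomial in the g_t is the
    exponential of a combination of the exp(e^t (n + 1)) with natural
    coefficients, and among finitely many exponentials whose exponents pairwise
    drift infinitely far apart one dominates all others ([exp_sum_diverges]).
    This principle serves twice: on the exponents, to show that the logarithms
    of two distinct monomials drift apart, and then on the monomials
    themselves. The free generators are the functions g_t(e(x, y)). *)

(** * Dominant terms in sums of exponentials *)

Definition diverges {R : realType} (f : R^nat) : Prop :=
  f @ \oo --> +oo \/ f @ \oo --> -oo.

Lemma divergesN (R : realType) (f : R^nat) :
  diverges f -> diverges (fun n => - f n).
Proof. by move=> [/cvgNrNy|/cvgNry]; [right|left]. Qed.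

(** Having a difference that tends to +oo is a strict order, and the hypothesis
    makes it total on s, so a finite nonempty s has a maximum. *)
Lemma exists_fastest (R : realType) (I : eqType) (psi : I -> R^nat)
    (s : seq I) :
  s != [::] ->
  {in s &, forall i j, i != j -> diverges (fun n => psi i n - psi j n)} ->
  exists2 i, i \in s & {in s, forall j, j != i ->
    (fun n => psi i n - psi j n) @ \oo --> +oo}.
Proof.
elim: s => // a s IH _ div.
have [->|s0] := eqVneq s [::].
  by exists a; rewrite ?mem_head // => j; rewrite inE => /eqP -> /eqP.
have [//||i si imax] := IH.
  by move=> i j si sj; apply: div; rewrite inE ?si ?sj orbT.
have [ai|ai] := eqVneq a i.
  exists i; first by rewrite inE si orbT.
  by move=> j; rewrite inE => /predU1P[->|]; [rewrite ai eqxx|exact: imax].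
have [i_s a_s] : i \in a :: s /\ a \in a :: s by rewrite !inE si eqxx orbT.
have [ga|gi] := div a i a_s i_s ai.
  exists a => // j; rewrite inE => /predU1P[-> /eqP //|sj _].
  have [->//|ji] := eqVneq j i.
  have gij := imax j sj ji.
  apply/cvgryPge => A; near=> n.
  rewrite -(subrKA (psi i n)) -[A]add0r lerD //; near: n.
    by move/cvgryPge: ga; apply.
  by move/cvgryPge: gij; apply.
exists i => // j; rewrite inE => /predU1P[-> _|]; last exact: imax.
apply/cvgNrNy; rewrite (_ : - _ = fun n => psi a n - psi i n) //.
by apply/funext => n; rewrite /GRing.opp /= opprB.
Unshelve. all: by end_near.
Qed.

Lemma cvg_sum0 (R : realType) (I : Type) (r : seq I) (P : pred I)
    (f : I -> R^nat) :
  (forall i, P i -> f i @ \oo --> 0) ->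
  \sum_(i <- r | P i) f i n @[n --> \oo] --> 0.
Proof.
move=> f0; elim: r => [|i r IH].
  under eq_cvg do rewrite big_nil.
  exact: cvg_cst.
under eq_cvg do rewrite big_cons.
case Pi : (P i) => //.
have := cvgD (f0 i Pi) IH; rewrite addr0; exact.
Qed.

(** Factoring out the exponential of the fastest psi_i leaves a factor that
    tends to its coefficient c_i, so the sum has the order of c_i exp(psi_i). *)
Lemma exp_sum_diverges (R : realType) (I : eqType) (c : I -> R)
    (psi : I -> R^nat) (s : seq I) :
  s != [::] -> uniq s -> {in s, forall i, c i != 0} ->
  {in s &, forall i j, i != j -> diverges (fun n => psi i n - psi j n)} ->
  {in s, forall i, psi i @ \oo --> +oo} ->
  diverges (fun n => \sum_(i <- s) c i * expR (psi i n)).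
Proof.
move=> s0 us c0 div psiy.
have [i si imax] := exists_fastest R I psi s s0 div.
(* Changing the sign of all coefficients only swaps the two infinities. *)
wlog ci : c c0 / 0 < c i.
  move=> wl; have := c0 i si; rewrite neq_lt => /orP[ci|]; last exact: wl.
  have sumN : (fun n => \sum_(i <- s) c i * expR (psi i n)) =
      (fun n => - \sum_(i <- s) - c i * expR (psi i n)).
    apply/funext => n; rewrite -sumrN; apply: eq_bigr => j _.
    by rewrite mulNr opprK.
  rewrite sumN; apply: divergesN; apply: wl => [j sj|].
  - by rewrite oppr_eq0 c0.
  - by rewrite oppr_gt0.
left.
have fact n : \sum_(j <- s) c j * expR (psi j n) =
    (c i + \sum_(j <- s | j != i) c j * expR (psi j n - psi i n)) *
    expR (psi i n).
  rewrite (bigD1_seq i) //= mulrDl mulr_suml; congr (_ + _).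
  by apply: eq_bigr => j _; rewrite -mulrA -expRD subrK.
have tail : (fun n => \sum_(j <- s | j != i) c j * expR (psi j n - psi i n))
    @ \oo --> (0 : R).
  under eq_cvg do rewrite big_seq_cond.
  apply: cvg_sum0 => j /andP[sj ji].
  have to0 : expR (psi j n - psi i n) @[n --> \oo] --> 0.
    under eq_cvg do rewrite -opprB.
    exact: (cvg_comp _ _ (imax j sj ji) (@cvgr_expR R)).
  have := cvgMl_tmp (a := c j) to0; rewrite mulr0. exact.
apply/cvgryPge => A; near=> n; rewrite fact.
have psi0 : 0 <= psi i n by near: n; move/cvgryPge: (psiy i si); apply.
(* The tail is eventually at least - c_i / 2, and exp(psi) >= 1 + psi. *)
apply: (@le_trans _ _ (c i / 2 * expR (psi i n))).
  rewrite mulrC -ler_pdivrMr ?divr_gt0 //.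
  apply: (le_trans _ (expR_ge1Dx _)); rewrite ler_wpDl //.
  by near: n; move/cvgryPge: (psiy i si); apply.
rewrite ler_wpM2r ?expR_ge0 // -lerBlDl.
rewrite [X in _ - X]splitr opprD addrA subrr sub0r.
near: n; move/cvgr_ge: tail; apply.
by rewrite oppr_lt0 divr_gt0.
Unshelve. all: by end_near.
Qed.

(** * Polynomials in double exponentials *)

(** The parameter enters as e^t so that all real t give positive rates; n + 1
    replaces n so that the value at 0 already determines t. *)
Definition double_exp {R : realType} (t : R) : R^nat :=
  fun n => expR (expR (expR t * n.+1%:R)).

Lemma linear_diverges (R : realType) (c : R) :
  c != 0 -> diverges (fun n => c * n.+1%:R).
Proof.
have pos (d : R) : 0 < d -> d * n.+1%:R @[n --> \oo] --> +oo.
  move=> d0; apply/cvgryPge => A; near=> n.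
  rewrite mulrC -ler_pdivrMr // -natr1 ler_wpDr //.
  by near: n; exact: nbhs_infty_ger.
rewrite neq_lt => /orP[c0|/pos]; last by left.
right; apply/cvgNry.
rewrite (_ : - _ = fun n => - c * n.+1%:R).
  by apply: pos; rewrite oppr_gt0.
by apply/funext => n; rewrite mulNr.
Unshelve. all: by end_near.
Qed.

Section polynomials_in_double_exponentials.
Context (R : realType) (k : nat) (t : 'I_k -> R) (t_inj : injective t).

Definition log_monomial (m : multinom k) : R^nat :=
  fun n => \sum_(i < k) (m i)%:R * expR (expR (t i) * n.+1%:R).

(** The difference is itself a sum of exponentials with distinct rates, over the
    variables in which the exponents of m and m' differ. *)
Lemma log_monomialB_diverges (m m' : multinom k) :
  m != m' -> diverges (fun n => log_monomial m n - log_monomial m' n).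
Proof.
move=> mm'.
pose s := [seq i <- enum 'I_k | m i != m' i].
have -> : (fun n => log_monomial m n - log_monomial m' n) =
    fun n => \sum_(i <- s)
      ((m i)%:R - (m' i)%:R) * expR (expR (t i) * n.+1%:R).
  apply/funext => n; rewrite big_filter big_enum_cond /= -sumrB.
  rewrite [LHS](bigID (fun i => m i != m' i)) /= [X in _ + X]big1 ?addr0.
    by apply: eq_bigr => i _; rewrite mulrBl.
  by move=> i /negPn/eqP ->; rewrite subrr.
apply: exp_sum_diverges.
- apply: contra mm' => /eqP s0; apply/eqP/mnmP => i.
  apply/eqP/negPn/negP => mi; have : i \in s by rewrite mem_filter mi mem_enum.
  by rewrite s0.
- by rewrite filter_uniq // enum_uniq.
- by move=> i; rewrite mem_filter => /andP[mi _]; rewrite subr_eq0 eqr_nat.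
- move=> i j _ _ ij; under eq_fun do rewrite -mulrBl.
  apply: linear_diverges.
  by rewrite subr_eq0 (inj_eq (@expR_inj R)) (inj_eq t_inj).
- move=> i _; have [//|bad] := linear_diverges _ _ (lt0r_neq0 (expR_gt0 (t i))).
  have [n] := @filter_ex _ _ _ _ (cvgrNy_lt bad 0).
  by rewrite ltNge mulr_ge0 ?expR_ge0.
Qed.

(** Comparison with the monomial 1, whose logarithm is 0; this is where the
    absence of a constant term matters. *)
Lemma log_monomial_cvgy (m : multinom k) :
  m != mnm0 -> log_monomial m @ \oo --> +oo.
Proof.
move=> m0; have := log_monomialB_diverges m mnm0 m0.
rewrite (_ : (fun n => _) = log_monomial m).
  case=> // bad; have [n] := @filter_ex _ _ _ _ (cvgrNy_lt bad 0).
  by rewrite ltNge sumr_ge0 // => i _; rewrite mulr_ge0 ?expR_ge0.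
apply/funext => n; rewrite [X in _ - X]big1 ?subr0 // => i _.
by rewrite mnm0E mul0r.
Qed.

Lemma meval_double_exp_diverges (P : mpoly k R) :
  P != 0 -> mcoeff mnm0 P = 0 ->
  diverges (fun n => meval (fun i => double_exp (t i) n) P).
Proof.
move=> P0 Pc.
have -> : (fun n => meval (fun i => double_exp (t i) n) P) =
    fun n => \sum_(m <- msupp P) mcoeff m P * expR (log_monomial m n).
  apply/funext => n; rewrite mevalE; apply: eq_bigr => m _; congr (_ * _).
  rewrite expR_sum; apply: eq_bigr => i _.
  by rewrite -expRM_natl.
apply: exp_sum_diverges.
- by rewrite msupp_eq0.
- exact: msupp_uniq.
- by move=> m; rewrite mcoeff_msupp.
- by move=> m m' _ _; exact: log_monomialB_diverges.
- move=> m; rewrite mcoeff_msupp => Pm; apply: log_monomial_cvgy.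
  by apply: contra Pm => /eqP ->; rewrite Pc.
Qed.

End polynomials_in_double_exponentials.

(** * Sierpinski's partition of the plane and iterated limits *)

(** Points are compared through a well-order of R all of whose initial segments
    are countable, A being the set where x comes no later than y. An arbitrary
    well-order le of R need not have this property. When it does not, the strict
    initial segment S below the first point with an uncountable segment has
    countable segments, and by CH the order of S can be transported to R along a
    bijection phi. *)
Lemma sierpinski_partition (R : realType) : continuum_hypothesis R ->
  exists A : rel R, (forall y, countable [set x | A x y]) /\
    (forall x, countable [set y | ~~ A x y]).
Proof.
move=> CH; have [le le_wo] := well_ordering_principle R.
have le_chain : wo_chain le predT by exact: withinW.
have le_total : total le by move=> x y; apply: (@wo_chainW R le predT).
have le_anti : antisymmetric le.
  by move=> x y; apply: (@wo_chain_antisymmetric R le predT).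
suff [phi phi_inj phi_le] : exists2 phi : R -> R, injective phi &
    forall y, countable [set z | le z (phi y)].
  have cnt y : countable [set x | le (phi x) (phi y)].
    have /countable_injP[g g_inj] := phi_le y.
    apply/countable_injP; exists (g \o phi) => x x' /set_mem xy /set_mem xy' /=.
    by move=> /g_inj => /(_ (mem_set xy) (mem_set xy'))/phi_inj.
  exists (fun x y => le (phi x) (phi y)); split => // x.
  apply: sub_countable (cnt x); apply: subset_card_le => y /= nxy.
  by have := le_total (phi x) (phi y); rewrite (negbTE nxy).
have [small|] := pselect (forall y, countable [set z | le z y]).
  by exists id.
move=> /existsNP[y0 y0_big].
pose big := [pred y : R | ~~ `[< countable [set z | le z y] >]].
have [|x0 [[x0_big x0_min] _]] := le_wo big.
  by exists y0; apply/asboolPn.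
pose S := [set z | le z x0 && (z != x0)].
have S_big : ~ countable S.
  move: x0_big => /asboolPn x0_big S_cnt; apply: x0_big.
  have : countable (\bigcup_(b in [set: bool]) (if b then S else [set x0])).
    by apply: bigcup_countable => [|[] _] //; exact: countableP.
  apply: sub_countable; apply: subset_card_le => z /= zx0.
  have [->|zNx0] := eqVneq z x0; first by exists false.
  by exists true => //; apply/andP.
have [//|] := CH S.
rewrite card_eq_sym => /card_set_bijP[phi [phiS phi_inj _]].
exists phi; first by move=> x y; apply: phi_inj; rewrite inE.
move=> y; have /andP[le_x0 ne_x0] := phiS y I.
apply: contrapT => /asboolPn phiy_big; move/negP: ne_x0; apply.
by apply/eqP/le_anti; rewrite le_x0 x0_min.
Qed.

Lemma sierpinski_coding (R : realType) : continuum_hypothesis R ->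
  exists (A : rel R) (e : R -> R -> nat),
    (forall y, {in [pred x | A x y] &, injective (e^~ y)}) /\
    (forall x, {in [pred y | ~~ A x y] &, injective (e x)}).
Proof.
move=> /sierpinski_partition[A [Acol Arow]].
have /choice[col col_inj] y : exists f : R -> nat,
    {in [set x | A x y] &, injective f} by exact/countable_injP.
have /choice[row row_inj] x : exists f : R -> nat,
    {in [set y | ~~ A x y] &, injective f} by exact/countable_injP.
exists A, (fun x y => if A x y then col y x else row x y); split.
  move=> y x x'; rewrite !inE => xy x'y; rewrite xy x'y.
  by apply: col_inj; rewrite inE.
move=> x y y'; rewrite !inE => xy xy'; rewrite (negbTE xy) (negbTE xy').
by apply: row_inj; rewrite inE.
Qed.

(** Double counting of the N^2 points of the grid: by injectivity of g a column
    has at most K points where a holds and a row at most K where it fails. *)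
Lemma grid_bound (N K : nat) (a : 'I_N -> 'I_N -> bool)
    (g : 'I_N -> 'I_N -> 'I_K) :
  (forall j, {in [pred i | a i j] &, injective (g^~ j)}) ->
  (forall i, {in [pred j | ~~ a i j] &, injective (g i)}) ->
  (N <= K + K)%N.
Proof.
move=> col_inj row_inj; case: N => [//|N] in a g col_inj row_inj *.
rewrite -(leq_pmul2l (ltn0Sn N)).
have -> : (N.+1 * N.+1 = \sum_i \sum_j (a i j + ~~ a i j))%N.
  under eq_bigr do under eq_bigr do rewrite addnC addn_negb.
  by rewrite !sum_nat_const !card_ord muln1.
under eq_bigr do rewrite big_split.
rewrite big_split /= mulnDr exchange_big /= leq_add //.
  rewrite -[X in (_ <= X * _)%N](card_ord N.+1) -sum_nat_const.
  apply: leq_sum => j _; rewrite -big_mkcond /= sum1_card.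
  by rewrite -[leqRHS](card_ord K); apply: leq_card_in (col_inj j).
rewrite -[X in (_ <= X * _)%N](card_ord N.+1) -sum_nat_const.
apply: leq_sum => i _; rewrite -big_mkcond /= sum1_card.
by rewrite -[leqRHS](card_ord K); apply: leq_card_in (row_inj i).
Qed.

Lemma no_iterated_limit (R : realType) (A : rel R) (e : R -> R -> nat)
    (h u v l : R^nat) :
  (forall y, {in [pred x | A x y] &, injective (e^~ y)}) ->
  (forall x, {in [pred y | ~~ A x y] &, injective (e x)}) ->
  diverges h -> injective u -> injective v ->
  (forall n, h (e (u n) (v m)) @[m --> \oo] --> l n) -> ~ cvgn l.
Proof.
move=> col_inj row_inj h_div u_inj v_inj hl l_cvg.
(* A bound on all l_n bounds the codes that the limits can see. *)
have [B lB] : exists B : R, forall n, `|l n| < B.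
  have [M [_ lM]] := cvg_seq_bounded l_cvg.
  exists (M + 2) => n; apply: (@le_lt_trans _ _ (M + 1)).
    by apply: lM; rewrite ?ltrDl.
  by rewrite ltrD2l ltr1n.
have [K hK] : exists K, forall k, `|h k| < B -> (k < K)%N.
  have : \forall k \near \oo, B <= `|h k|.
    case: h_div => h_div; near=> k.
      apply: le_trans (ler_norm _); near: k.
      by move/cvgryPge: h_div; apply.
    rewrite -normrN; apply: le_trans (ler_norm _); rewrite lerNr; near: k.
    by move/cvgrNyPle: h_div; apply.
  move=> [K _ hK]; exists K => k; apply: contraTT; rewrite -leqNgt -leNgt.
  exact: hK.
pose N := (K + K).+1.
(* Only finitely many rows are used, so one M serves them all. *)
have [M eK] : exists M, forall (n : 'I_N) m, (M <= m)%N ->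
    (e (u n) (v m) < K)%N.
  have : \forall m \near \oo, forall n : 'I_N, (e (u n) (v m) < K)%N.
    apply: filter_forall => n; near=> m; apply: hK.
    near: m; apply: cvgr_norm_lt (hl n) _ (lB n).
  by move=> [M _ eM]; exists M => n m /eM; exact.
suff : (N <= K + K)%N by rewrite ltnn.
apply: (@grid_bound N K (fun n m => A (u n) (v (M + m)%N))
  (fun n m => Ordinal (eK n (M + m)%N (leq_addr _ _)))).
- move=> m n n' An An' /(congr1 val) /= eq_e.
  exact/val_inj/u_inj/(col_inj _ _ _ An An' eq_e).
- move=> n m m' Am Am' /(congr1 val) /= eq_e.
  exact/val_inj/(@addnI M)/v_inj/(row_inj _ _ _ Am Am' eq_e).
Unshelve. all: by end_near.
Qed.

(** * Free generators *)

Lemma poly_inE (R : realType) (T : pointedType) (k : nat) (P : mpoly k R)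
    (y : 'I_k -> T -> R) (z : T) :
  poly_in P y z = meval (fun i => y i z) P.
Proof.
rewrite /poly_in mevalE /mmap fct_sumE; apply: eq_bigr => m _.
rewrite /mmap1 /= fct_prodE [LHS]mulr_algl.
congr (_ * _); apply: eq_bigr => i _.
by rewrite exprfctE.
Qed.

Theorem theorem19 (R : realType) (CH : continuum_hypothesis R) :
  @strongly_algebrable R ((R * R)%type -> R) R [set: R]
    [set f : (R * R)%type -> R | nowhere_feebly_continuous f].
Proof.
have [A [e [col_inj row_inj]]] := sierpinski_coding R CH.
pose F (t : R) : R * R -> R := fun z => double_exp t (e z.1 z.2).
have F_inj : injective F.
  move=> s t /(congr1 (@^~ (0, 0))); rewrite /F /double_exp /=.
  by move=> /expR_inj/expR_inj/mulIf-/(_ (lt0r_neq0 (ltr0Sn _ _)))/expR_inj.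
exists (F @` setT); split; first by apply: inj_card_eq => x y _ _; exact: F_inj.
move=> k P y P0 Pc y_inj yF.
have /choice[t yE] i : exists t, y i = F t by have [t _ <-] := yF i; exists t.
have t_inj : injective t.
  by move=> i j tij; apply: y_inj; rewrite !yE tij.
pose h : R^nat := fun n => meval (fun i => double_exp (t i) n) P.
have h_div : diverges h := meval_double_exp_diverges R k t t_inj P P0 Pc.
have polyE z : poly_in P y z = h (e z.1 z.2).
  by rewrite poly_inE; congr (meval _ P); apply/funext => i; rewrite yE.
have no_lim u v l := no_iterated_limit R A e h u v l col_inj row_inj h_div.
split.
  apply/eqP => poly0.
  have nat_inj : injective (fun n => n%:R : R).
    by move=> m n /eqP; rewrite eqr_nat => /eqP.
  apply: (no_lim _ _ (fun=> 0) nat_inj nat_inj); last exact: is_cvg_cst.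
  move=> n; rewrite (_ : (fun m => _) = fun=> 0); first exact: cvg_cst.
  by apply/funext => m; rewrite -(polyE (n%:R, m%:R)) poly0.
move=> z [u [v [l [[u_dec _] [v_dec _] ul lz]]]].
have dec_inj (w : R^nat) : decreasing_seq w -> injective w.
  by move=> w_dec m n mn; apply/eqP; rewrite eqn_leq -!w_dec mn lexx.
apply: (no_lim u v l (dec_inj u u_dec) (dec_inj v v_dec)).
  by move=> n; have := ul n; under eq_fun do rewrite polyE.
by apply/cvg_ex; exists (poly_in P y z).
Qed.
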